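(* Let $\mathcal{E}$ be a finite-dimensional supersolvable (not necessarily evolution) algebra over a field. Then $\mathcal{E}$ is lower semimodular.
   Context: An algebra over a field is a vector space with a bilinear product (not necessarily associative or commutative); ideals are two-sided. A finite-dimensional algebra $\mathcal{E}$ of dimension $n$ is supersolvable if there is a chain $0=I_0\subsetneq I_1\subsetneq\dots\subsetneq I_n=\mathcal{E}$ of ideals of $\mathcal{E}$ with $\dim I_i=i$ for all $0\leq i\leq n$. $\langle U,V\rangle$ denotes the subalgebra generated by $U\cup V$. $\mathcal{E}$ is lower semimodular if for all subalgebras $U,V$ of $\mathcal{E}$ such that $V$ is a maximal subalgebra of $\langle U,V\rangle$, $U\cap V$ is a maximal subalgebra of $U$ (maximal subalgebras being proper). *)

(* Defs.v *)
From mathcomp Require Import all_boot all_order all_algebra.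
From mathcomp Require Import sesquilinear.

Set Implicit Arguments.
Unset Strict Implicit.
Unset Printing Implicit Defensive.

Import GRing.Theory.
Local Open Scope ring_scope.

(* A finite-dimensional algebra is a vectType [E] with an arbitrary bilinear  *)
(* product [mul]; neither associativity, commutativity nor a unit is assumed. *)
(* Subalgebras need not be unital and may be zero.                            *)
Section NonassocAlgebra.

Variables (K : fieldType) (E : vectType K) (mul : {bilinear E -> E -> E}).
Implicit Types (U V W X : {vspace E}).

Definition subalgebra U : Prop :=
  forall x y, x \in U -> y \in U -> mul x y \in U.

Definition ideal U : Prop :=
  forall a x, a \in U -> mul a x \in U /\ mul x a \in U.

Definition supersolvable : Prop :=
  let n := \dim {:E} in
  exists I : nat -> {vspace E},
    [/\ I 0%N = 0%VS,
        I n = fullv,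
        forall i, (i < n)%N -> (I i <= I i.+1)%VS && (I i != I i.+1) &
        forall i, (i <= n)%N -> ideal (I i) /\ \dim (I i) = i].

Definition maximal_subalgebra V W : Prop :=
  [/\ subalgebra V, (V <= W)%VS, V != W &
      forall X, subalgebra X -> (V <= X)%VS -> (X <= W)%VS -> X = V \/ X = W].

Definition prod_span U V : {vspace E} :=
  <<[seq mul x y | x <- vbasis U, y <- vbasis V]>>%VS.

(* The ascending sequence W, W + WW, ... is constant from index \dim {:E} on, *)
(* for dimension reasons; [gen_subalgebraP] below is the universal property.  *)
Definition gen_subalgebra U V : {vspace E} :=
  iter (\dim {:E}) (fun W => W + prod_span W W)%VS (U + V)%VS.

Definition lower_semimodular : Prop :=
  forall U V, subalgebra U -> subalgebra V ->
    maximal_subalgebra V (gen_subalgebra U V) ->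
    maximal_subalgebra (U :&: V)%VS U.

Lemma mem_prod_span U V x y :
  x \in U -> y \in V -> mul x y \in prod_span U V.
Proof.
move=> /coord_vbasis -> /coord_vbasis ->.
rewrite linear_sumlz; apply: memv_suml => i _.
rewrite linear_sumr; apply: memv_suml => j _.
rewrite linearZl_LR linearZr_LR; apply/memvZ/memvZ/memv_span.
by apply/allpairsP; exists ((vbasis U)`_i, (vbasis V)`_j);
  split=> //; apply/mem_nth; rewrite size_tuple.
Qed.

Lemma prod_span_sub U V W :
  (forall x y, x \in U -> y \in V -> mul x y \in W) -> (prod_span U V <= W)%VS.
Proof.
move=> h; apply/span_subvP => _ /allpairsP[[x y] /= [xU yV ->]].
by apply: h; apply: vbasis_mem.
Qed.

Lemma gen_subalgebraP U V :
  [/\ subalgebra (gen_subalgebra U V),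
      (U <= gen_subalgebra U V)%VS, (V <= gen_subalgebra U V)%VS &
      forall W, subalgebra W -> (U <= W)%VS -> (V <= W)%VS ->
        (gen_subalgebra U V <= W)%VS].
Proof.
pose f W := (W + prod_span W W)%VS.
have f_ge W : (W <= f W)%VS by exact: addvSl.
have iter_ge n : (U + V <= iter n f (U + V))%VS.
  by elim: n => //= n IH; apply: subv_trans IH (f_ge _).
have UVg : (U + V <= gen_subalgebra U V)%VS by exact: iter_ge.
split.
- have stab n : f (iter n f (U + V)%VS) = iter n f (U + V)%VS \/
                (n <= \dim (iter n f (U + V)%VS))%N.
    elim: n => [|n [IH|IH]]; [by right | by left; rewrite /= !IH |].
    have [/eqP e|ne] := boolP (f (iter n f (U + V)%VS) == iter n f (U + V)%VS).
      by left; rewrite /= !e.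
    right; apply: leq_ltn_trans IH _; rewrite ltnNge /=.
    by apply: contra ne => le; rewrite eq_sym eqEdim f_ge.
  have fG : f (gen_subalgebra U V) = gen_subalgebra U V.
    have [//|full] := stab (\dim {:E}).
    have G1 : gen_subalgebra U V = fullv.
      by apply/eqP; rewrite eqEdim subvf.
    by apply/eqP; rewrite eqEsubv f_ge G1 subvf.
  move=> x y xG yG; rewrite -fG.
  by apply: subvP (addvSr _ _) _ _; apply: mem_prod_span.
- exact: subv_trans (addvSl _ _) UVg.
- exact: subv_trans (addvSr _ _) UVg.
- move=> W sW UW VW; rewrite /gen_subalgebra; elim: (\dim _) => [|n IH] /=.
    by rewrite subv_add UW.
  rewrite subv_add IH /=; apply: prod_span_sub => x y xI yI.
  by apply: sW; apply: (subvP IH).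
Qed.

End NonassocAlgebra.

(* Main.v *)
(* The sums of a maximal subalgebra V with the ideals I_i, cut down to the     *)
(* algebra S in which V is maximal, are subalgebras between V and S, and grow  *)
(* by at most one dimension at each step; the first one that is not V is S, so *)
(* V has codimension 1 in S. For S = <U, V> the intersection of U and V then   *)
(* has codimension 1 in U, which makes it maximal.                             *)
Require Import Defs.
From mathcomp Require Import all_boot all_order all_algebra.
From mathcomp Require Import sesquilinear.

Import GRing.Theory.
Local Open Scope ring_scope.

(** Everything reduces to counting dimensions: under supersolvability a maximal subalgebra of any
    subalgebra has codimension 1 ([dim_maximal_subalgebra]); the dimension formula carries this
    bound from [V] in [U + V] to [U :&: V] in [U] ([dimv_cap_leS]); and codimension 1 leaves no room
    for a subalgebra strictly in between ([maximal_subalgebra_codim1]). *)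

Lemma dimv_cap_leS (K : fieldType) (E : vectType K) (U V : {vspace E}) :
  (\dim (U + V) <= (\dim V).+1)%N -> (\dim U <= (\dim (U :&: V)).+1)%N.
Proof.
by move=> le; rewrite -(leq_add2r (\dim V)) -dimv_sum_cap addnC addSnnS leq_add2l.
Qed.

(** [J] enlarges [V + I] only by its dimension modulo [(V + I) :&: J], which contains [I]. *)
Lemma dimv_add_leS (K : fieldType) (E : vectType K) (V I J : {vspace E}) :
  (I <= J)%VS -> (\dim J <= (\dim I).+1)%N ->
  (\dim (V + J) <= (\dim (V + I)).+1)%N.
Proof.
move=> IJ le; have le' : (\dim J <= (\dim ((V + I) :&: J)).+1)%N.
  by apply: leq_trans le _; rewrite ltnS dimvS // subv_cap addvSr.
have := dimv_sum_cap (V + I) J; rewrite -addvA (addv_idPr IJ) => e.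
by rewrite -(leq_add2r (\dim ((V + I) :&: J))) e addSnnS leq_add2l.
Qed.

Section Subalgebras.

Variables (K : fieldType) (E : vectType K) (mul : {bilinear E -> E -> E}).
Implicit Types (I S U V : {vspace E}).

Lemma subalgebra_cap U V :
  subalgebra mul U -> subalgebra mul V -> subalgebra mul (U :&: V)%VS.
Proof.
move=> sU sV x y /memv_capP[xU xV] /memv_capP[yU yV].
by rewrite memv_cap sU ?sV.
Qed.

Lemma subalgebra_add_ideal V I :
  subalgebra mul V -> ideal mul I -> subalgebra mul (V + I)%VS.
Proof.
(* Expand [(v + a)(w + b)] as [vw + (vb + a(w + b))]: the first term is in [V], the other two in the
   two-sided ideal [I]. *)
move=> sV iI _ _ /memv_addP[v vV [a aI ->]] /memv_addP[w wV [b bI ->]].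
rewrite linearDl linearDr -addrA; apply: memv_add; first exact: sV.
by apply: rpredD; [case: (iI b v bI) | case: (iI a (w + b) aI)].
Qed.

Lemma dim_maximal_subalgebra V S :
  supersolvable mul -> subalgebra mul S -> maximal_subalgebra mul V S ->
  (\dim S <= (\dim V).+1)%N.
Proof.
move=> [I [I0 In mono dimI]] sS [sV VS neVS maxV].
have [//|gt] := leqP (\dim S) (\dim V).+1.
(* If the codimension exceeded 1, no [V + I i] would meet [S] outside [V]; but the last ideal is the
   whole algebra, which would force [S = V]. *)
suff capV i : (i <= \dim {:E})%N -> (S :&: (V + I i))%VS = V.
  by move: neVS; rewrite -(capV _ (leqnn _)) In addvf capvf eqxx.
elim: i => [_|i IH lt]; first by rewrite I0 addv0; apply/capv_idPr.
have [iI dI'] := dimI _ lt; have [_ dI] := dimI _ (ltnW lt).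
have /andP[II' _] := mono _ lt.
case: (maxV (S :&: (V + I i.+1))%VS) => //.
- exact/subalgebra_cap/subalgebra_add_ideal.
- by rewrite subv_cap VS addvSl.
- exact: capvSl.
(* Otherwise [S] lies in [V + I i.+1], at most one dimension above [V + I i], so [V], which is
   [S :&: (V + I i)] by induction, has codimension at most 1 in [S]. *)
move=> /capv_idPl SVI'; move: gt; rewrite ltnNge -{1}(IH (ltnW lt)) => /negP[].
apply: dimv_cap_leS; apply: leq_trans (@dimv_add_leS _ _ V _ _ II' _).
  by apply: dimvS; rewrite subv_add SVI' addvS.
by rewrite dI dI'.
Qed.

Lemma maximal_subalgebra_codim1 V U :
  subalgebra mul V -> (V <= U)%VS -> V != U -> (\dim U <= (\dim V).+1)%N ->
  maximal_subalgebra mul V U.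
Proof.
move=> sV VU ne le; split=> // X _ VX XU.
have [/eqP<-|neVX] := boolP (V == X); [by left | right].
apply/eqP; rewrite eqEdim XU (leq_trans le) // ltnNge.
by apply: contra neVX => leXV; rewrite eqEdim VX.
Qed.

End Subalgebras.

Theorem proposition4p3 (K : fieldType) (E : vectType K)
    (mul : {bilinear E -> E -> E}) :
  supersolvable mul -> lower_semimodular mul.
Proof.
move=> ss U V sU sV maxV.
have [sG UG VG minG] := gen_subalgebraP mul U V.
have leG := dim_maximal_subalgebra _ _ _ _ _ ss sG maxV.
apply: maximal_subalgebra_codim1; [exact: subalgebra_cap | exact: capvSl | |].
  (* If [U :&: V = U], then [V] contains [U], hence the whole generated subalgebra, against
     properness. *)
  have [_ _ neVG _] := maxV; apply: contra neVG => /eqP/capv_idPl UV.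
  by rewrite eqEsubv VG minG.
by apply: dimv_cap_leS; apply: leq_trans leG; rewrite dimvS // subv_add UG.
Qed.
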